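(* Let $f=\frac1n\sum_{i=1}^n f_i$, $f_i:\mathbb{R}^d\to\mathbb{R}$, and let $(\omega_k)_{k\ge 0}$ be the iterates generated by Algorithm 1 (described in the context) from $\omega_0\in\mathbb{R}^d$, with strong Wolfe parameters $0<\sigma_1<\sigma_2<1$. Assume: (1) there are constants $\mu,L>0$ such that $\mu I\prec\nabla^2 f_i(\omega)\prec LI$ for all $\omega\in\mathbb{R}^d$ and all $1\le i\le n$; (2) there are constants $\alpha_1,\alpha_2$ such that every step size satisfies $\alpha_1\le\alpha_k\le\alpha_2$; (3) there is a constant $\beta$ such that $\beta_k\le\frac{\|g_k\|^2}{\|g_{k-1}\|^2}\le\beta$ for all $k\ge1$. If $$0<\alpha_1<\frac{1-\beta}{2L\sigma_1},$$ then, with $\xi=1-2\mu\sigma_1\alpha_1$, one has $\xi<1$ and there is a constant $C$ (independent of $k$) such that for all $k>0$ $$E(f(\omega_k))-f(\omega^* )\le C\,\xi^k\,\bigl(E(f(\omega_0))-f(\omega^* )\bigr),$$ where $\omega^*$ is the unique minimizer of $f$.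
   Context: Notation. For a mini-batch $S$ (a sample of $|S|\ge2$ indices drawn uniformly at random with replacement from $\{1,\dots,n\}$; the size $|S|$ is fixed), $f_S=\frac1{|S|}\sum_{j\in S}f_j$ and $\nabla f_S=\frac1{|S|}\sum_{j\in S}\nabla f_j$. $E$ denotes expectation over the random mini-batches. Products and quotients with the vector $\gamma^*$ below are componentwise. The symbols $\alpha_1,\alpha_2$ in assumption (2) are constants bounding all step sizes, not the step sizes of iterations 1 and 2. Algorithm 1 (stochastic conjugate gradient with the minimal variance gradient estimate). Initialization: given $\omega_0$, store a table of gradients $\nabla f_i(\omega_{[0]}):=\nabla f_i(\omega_0)$, $i=1,\dots,n$; set $\mu_0=\frac1n\sum_{i=1}^n\nabla f_i(\omega_{[0]})$, $g_0=\mu_0$, $d_0=-g_0$. For $k=1,2,\dots$: - Choose the step size $\alpha_{k-1}$ and set $\omega_k=\omega_{k-1}+\alpha_{k-1}d_{k-1}$. The step sizes satisfy, for all $k\ge0$, the strong Wolfe conditions $$f_{S_k}(\omega_k+\alpha_kd_k)\le f_{S_k}(\omega_k)+\sigma_1\alpha_k g_k^Td_k,\qquad |g_{k+1}^Td_k|\le-\sigma_2 g_k^Td_k,$$ where $f_{S_0}:=f$. - Draw a mini-batch $S_k$. For each $j\in S_k$ let $X_j=\nabla f_j(\omega_k)$ and $Y_j=\nabla f_j(\omega_{[k-1]})$ (the stored gradient of index $j$). Let $\bar X,\bar Y$ be their averages over $S_k$ and define, for each component $r=1,\dots,d$, $$\gamma^{*(r)}=\frac{s_{XY}^{(r)}}{(s_Y^2)^{(r)}},\quad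 s_{XY}^{(r)}=\frac{1}{|S|-1}\sum_{j\in S_k}(X_j^{(r)}-\bar X^{(r)})(Y_j^{(r)}-\bar Y^{(r)}),\quad (s_Y^2)^{(r)}=\frac1{|S|-1}\sum_{j\in S_k}(Y_j^{(r)}-\bar Y^{(r)})^2.$$ - Set $g_k=\nabla f_{S_k}(\omega_k)-\gamma^*(\bar Y-\mu_{k-1})$. - Set $\beta_k=\max\{0,\min\{\beta_k^{PRP},\beta_k^{FR}\}\}$ with $\beta_k^{PRP}=\frac{g_k^T(g_k-g_{k-1})}{\|g_{k-1}\|^2}$ and $\beta_k^{FR}=\frac{\|g_k\|^2}{\|g_{k-1}\|^2}$, and $d_k=-g_k+\beta_kd_{k-1}$. - Update the table: $\nabla f_j(\omega_{[k]})=\nabla f_j(\omega_k)$ for $j\in S_k$, $\nabla f_j(\omega_{[k]})=\nabla f_j(\omega_{[k-1]})$ for $j\notin S_k$; and $\mu_k=\frac1n\sum_{j=1}^n\nabla f_j(\omega_{[k]})$. Standing property: the gradient estimate is taken to be unbiased, $E(g_k)=\nabla f(\omega_k)$ (expectation over the sampling of the mini-batch, $\omega_k$ given). *)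

(* Defs.v *)
From HB Require Import structures.
From mathcomp Require Import all_boot all_order all_algebra.
From mathcomp Require Import all_classical all_reals all_analysis.

Set Implicit Arguments.
Unset Strict Implicit.
Unset Printing Implicit Defensive.

Import Order.TTheory GRing.Theory Num.Theory.
Import numFieldNormedType.Exports.

Local Open Scope ring_scope.

(* The library norm on 'rV[R]_d is the sup norm, so the Euclidean inner
   product and squared norm are introduced here. *)
Definition dot (R : realType) (d : nat) (u v : 'rV[R]_d) : R :=
  \sum_(r < d) u 0 r * v 0 r.

Definition sqnorm (R : realType) (d : nat) (u : 'rV[R]_d) : R := dot u u.

Definition gradient (R : realType) (d : nat) (f : 'rV[R]_d -> R)
    (w : 'rV[R]_d) : 'rV[R]_d :=
  \row_(r < d) 'D_(delta_mx 0 r) f w.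

Definition hessian (R : realType) (d : nat) (f : 'rV[R]_d -> R)
    (w : 'rV[R]_d) : 'M[R]_d :=
  \matrix_(r < d, s < d)
    'D_(delta_mx 0 r) (fun u : 'rV[R]_d => 'D_(delta_mx 0 s) f u) w.

Definition twice_differentiable (R : realType) (d : nat)
    (f : 'rV[R]_d -> R) : Prop :=
  forall w : 'rV[R]_d, differentiable f w /\ differentiable (gradient f) w.

(* Strict Loewner order.  It is only used between scalar matrices and Hessians
   of twice differentiable functions, whose symmetry is automatic. *)
Definition loewner_lt (R : realType) (d : nat) (A B : 'M[R]_d) : Prop :=
  forall x : 'rV[R]_d, x != 0 -> 0 < (x *m (B - A) *m x^T) 0 0.

Definition objective (R : realType) (n d : nat)
    (f : 'I_n -> 'rV[R]_d -> R) (w : 'rV[R]_d) : R :=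
  n%:R^-1 * \sum_(i < n) f i w.

(* A sample of b indices with replacement: order and repetitions matter, so
   the uniform law on these tuples is b independent uniform draws. *)
Definition batch (n b : nat) := b.-tuple 'I_n.

Definition batch_objective (R : realType) (n b d : nat)
    (f : 'I_n -> 'rV[R]_d -> R) (S : batch n b) (w : 'rV[R]_d) : R :=
  b%:R^-1 * \sum_(j <- S) f j w.

Definition batch_mean (R : realType) (n b d : nat) (S : batch n b)
    (X : 'I_n -> 'rV[R]_d) : 'rV[R]_d :=
  b%:R^-1 *: \sum_(j <- S) X j.

Definition full_mean (R : realType) (n d : nat)
    (X : 'I_n -> 'rV[R]_d) : 'rV[R]_d :=
  n%:R^-1 *: \sum_(j < n) X j.

Definition sample_cov (R : realType) (n b d : nat) (S : batch n b)
    (X Y : 'I_n -> 'rV[R]_d) (r : 'I_d) : R :=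
  (b.-1)%:R^-1 * \sum_(j <- S)
    (X j 0 r - batch_mean S X 0 r) * (Y j 0 r - batch_mean S Y 0 r).

(* Sampling with replacement gives s_Y^2 = 0 with positive probability (all
   draws equal), and then s_XY / s_Y^2 is 0/0.  The vector theta is the value
   given to gamma^* in that case; it is left arbitrary, so that no convention
   for 0/0 is imposed. *)
Definition gamma_star (R : realType) (n b d : nat) (S : batch n b)
    (theta : 'rV[R]_d) (X Y : 'I_n -> 'rV[R]_d) : 'rV[R]_d :=
  \row_(r < d) (if sample_cov S Y Y r == 0 then theta 0 r
                else sample_cov S X Y r / sample_cov S Y Y r).

(* The data available once the mini-batch of iteration k has been processed:
   omega_k, g_k, d_k and the table j |-> nabla f_j(omega_[k]). *)
Record state (R : realType) (n d : nat) := State {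
  iterate : 'rV[R]_d;
  estimate : 'rV[R]_d;
  direction : 'rV[R]_d;
  stored : 'I_n -> 'rV[R]_d
}.

Definition cg_init (R : realType) (n d : nat) (f : 'I_n -> 'rV[R]_d -> R)
    (w0 : 'rV[R]_d) : state R n d :=
  let table := fun i : 'I_n => gradient (f i) w0 in
  State w0 (full_mean table) (- full_mean table) table.

Definition estimate_of (R : realType) (n b d : nat)
    (f : 'I_n -> 'rV[R]_d -> R) (S : batch n b) (theta : 'rV[R]_d)
    (w : 'rV[R]_d) (table : 'I_n -> 'rV[R]_d) : 'rV[R]_d :=
  let X := fun j : 'I_n => gradient (f j) w in
  let gamma := gamma_star S theta X table in
  let correction := batch_mean S table - full_mean table in
  batch_mean S X - \row_(r < d) (gamma 0 r * correction 0 r).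

Definition beta_prp (R : realType) (d : nat) (gprev g : 'rV[R]_d) : R :=
  dot g (g - gprev) / sqnorm gprev.

Definition beta_fr (R : realType) (d : nat) (gprev g : 'rV[R]_d) : R :=
  sqnorm g / sqnorm gprev.

Definition beta_cg (R : realType) (d : nat) (gprev g : 'rV[R]_d) : R :=
  Num.max 0 (Num.min (beta_prp gprev g) (beta_fr gprev g)).

Definition cg_step (R : realType) (n b d : nat) (f : 'I_n -> 'rV[R]_d -> R)
    (S : batch n b) (theta : 'rV[R]_d) (a : R) (s : state R n d) :
    state R n d :=
  let w := iterate s + a *: direction s in
  let g := estimate_of f S theta w (stored s) in
  let dir := - g + beta_cg (estimate s) g *: direction s in
  let table :=
    fun j : 'I_n => if j \in S then gradient (f j) w else stored s j in
  State w g dir table.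

(* A history S_k :: ... :: S_1 lists the mini-batches drawn so far, most recent
   first; [run alpha theta f w0 h] is the state reached after it.  The step
   size alpha_k is chosen after S_k and before S_{k+1} is drawn: it is the
   value of alpha at the history of length k. *)
Fixpoint run (R : realType) (n b d : nat) (alpha : seq (batch n b) -> R)
    (theta : seq (batch n b) -> 'rV[R]_d) (f : 'I_n -> 'rV[R]_d -> R)
    (w0 : 'rV[R]_d) (h : seq (batch n b)) : state R n d :=
  match h with
  | [::] => cg_init f w0
  | B :: h' => cg_step f B (theta h) (alpha h') (run alpha theta f w0 h')
  end.

(* f_{S_k}, with the convention f_{S_0} = f. *)
Definition last_objective (R : realType) (n b d : nat)
    (f : 'I_n -> 'rV[R]_d -> R) (h : seq (batch n b)) : 'rV[R]_d -> R :=
  match h with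
  | [::] => objective f
  | B :: _ => batch_objective f B
  end.

(* Expectation over S_1, ..., S_k independent and uniform, that is, under the
   uniform law on histories of length k. *)
Definition expect (R : realType) (n b k : nat)
    (X : k.-tuple (batch n b) -> R) : R :=
  (#|{: k.-tuple (batch n b)}|)%:R^-1 * \sum_h X h.

(* Conditional expectation of a random vector given the event A. *)
Definition cond_expect (R : realType) (n b d k : nat)
    (A : pred (k.-tuple (batch n b))) (X : k.-tuple (batch n b) -> 'rV[R]_d) :
    'rV[R]_d :=
  (#|A|)%:R^-1 *: \sum_(h | A h) X h.

(* E(g_k | omega_k) = nabla f(omega_k).  As omega_k takes finitely many values,
   this is conditioning on each event {omega_k = omega_k(h0)}. *)
Definition unbiased (R : realType) (n b d : nat)
    (alpha : seq (batch n b) -> R) (theta : seq (batch n b) -> 'rV[R]_d)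
    (f : 'I_n -> 'rV[R]_d -> R) (w0 : 'rV[R]_d) : Prop :=
  let st := run alpha theta f w0 in
  forall (k : nat) (h0 : k.-tuple (batch n b)),
    cond_expect (fun h : k.-tuple (batch n b) =>
                   iterate (st h) == iterate (st h0))
                (fun h => estimate (st h))
    = gradient (objective f) (iterate (st h0)).

Definition strong_wolfe (R : realType) (n b d : nat) (sigma1 sigma2 : R)
    (alpha : seq (batch n b) -> R) (theta : seq (batch n b) -> 'rV[R]_d)
    (f : 'I_n -> 'rV[R]_d -> R) (w0 : 'rV[R]_d) : Prop :=
  let st := run alpha theta f w0 in
  forall h : seq (batch n b),
    let w := iterate (st h) in
    let g := estimate (st h) in
    let dir := direction (st h) in
    last_objective f h (w + alpha h *: dir)
      <= last_objective f h w + sigma1 * alpha h * dot g dir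
    /\ (forall S : batch n b,
          `| dot (estimate (st (S :: h))) dir | <= - sigma2 * dot g dir).

(* The bound beta_k <= ||g_k||^2 / ||g_{k-1}||^2 <= beta.  Division by 0 yields
   0 in the library, so the second clause states that a quotient with zero
   denominator and nonzero numerator is not bounded; it holds vacuously
   whenever no g_k vanishes, i.e. whenever all the quotients are defined. *)
Definition bounded_ratio (R : realType) (n b d : nat) (beta : R)
    (alpha : seq (batch n b) -> R) (theta : seq (batch n b) -> 'rV[R]_d)
    (f : 'I_n -> 'rV[R]_d -> R) (w0 : 'rV[R]_d) : Prop :=
  let st := run alpha theta f w0 in
  forall (h : seq (batch n b)) (S : batch n b),
    let gprev := estimate (st h) in
    let g := estimate (st (S :: h)) in
    beta_cg gprev g <= sqnorm g / sqnorm gprev <= beta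
    /\ (gprev = 0 -> g = 0).

(* Main.v *)
Require Import Defs.
From HB Require Import structures.
From mathcomp Require Import all_boot all_order all_algebra.
From mathcomp Require Import all_classical all_reals all_analysis.
From mathcomp Require Import ring lra.

Set Implicit Arguments.
Unset Strict Implicit.
Unset Printing Implicit Defensive.

Import Order.TTheory GRing.Theory Num.Theory.
Import numFieldNormedType.Exports.

Local Open Scope ring_scope.

(** Write g_k for the gradient estimates.  The ratio bound
    ||g_k||^2 <= beta ||g_{k-1}||^2 holds on every history of mini-batches, so
    ||g_k||^2 <= beta^k ||g_0||^2 surely, and g_0 is the exact gradient of
    F = objective f at w0 ([sqnorm_estimate_le]).  By unbiasedness the true
    gradient at omega_k is an average of estimates g_k, and the squared norm is
    convex, so ||grad F(omega_k)||^2 <= beta^k ||grad F(w0)||^2, again on every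
    history ([sqnorm_gradient_le]).

    Two inequalities relate gradients to the gap above the minimum
    Fmin of F.  The lower Hessian bound gives the Polyak-Lojasiewicz inequality
    2 mu (F(w) - Fmin) <= ||grad F(w)||^2 ([polyak_lojasiewicz]) and the upper
    one gives ||grad F(w)||^2 <= 2 L (F(w) - Fmin) ([gradient_le_gap]).
    Together, on every history,
      F(omega_k) - Fmin <= (L / mu) beta^k (F(w0) - Fmin).
    Finally the condition on alpha1 says 2 L sigma1 alpha1 < 1 - beta, and
    mu < L unless w0 is already optimal, so that beta <= xi; hence C = L / mu,
    and taking expectations concludes.

    The minimizer exists because strong convexity makes the sublevel set of
    F(0) bounded, hence compact ([minimizer_exists]). *)

(** * The Euclidean inner product *)

Section Euclidean.
Variables (R : realType) (d : nat).
Implicit Types (u v w : 'rV[R]_d) (a : R).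

Lemma dotC u v : dot u v = dot v u.
Proof. by apply: eq_bigr => r _; rewrite mulrC. Qed.

Lemma dotDr u v w : dot u (v + w) = dot u v + dot u w.
Proof. by rewrite -big_split; apply: eq_bigr => r _; rewrite mxE mulrDr. Qed.

Lemma dotZr a u v : dot u (a *: v) = a * dot u v.
Proof. by rewrite mulr_sumr; apply: eq_bigr => r _; rewrite mxE mulrCA. Qed.

Lemma dotDl u v w : dot (u + v) w = dot u w + dot v w.
Proof. by rewrite !(dotC _ w) dotDr. Qed.

Lemma dotZl a u v : dot (a *: u) v = a * dot u v.
Proof. by rewrite !(dotC _ v) dotZr. Qed.

Lemma dotNr u v : dot u (- v) = - dot u v.
Proof. by rewrite -scaleN1r dotZr mulN1r. Qed.

Lemma dot0r u : dot u 0 = 0.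
Proof. by rewrite -(scale0r u) dotZr mul0r. Qed.

Lemma dot_sumr (I : finType) (P : pred I) u (x : I -> 'rV[R]_d) :
  dot u (\sum_(i | P i) x i) = \sum_(i | P i) dot u (x i).
Proof. exact: (big_morph _ (dotDr u) (dot0r u)). Qed.

Lemma sqnormZ a u : sqnorm (a *: u) = a ^+ 2 * sqnorm u.
Proof. by rewrite /sqnorm dotZl dotZr mulrA. Qed.

Lemma sqnormD u v : sqnorm (u + v) = sqnorm u + 2 * dot u v + sqnorm v.
Proof. rewrite /sqnorm dotDl !dotDr (dotC v u); ring. Qed.

Lemma sqnormN u : sqnorm (- u) = sqnorm u.
Proof. by rewrite -scaleN1r sqnormZ sqrrN expr1n mul1r. Qed.

Lemma sqr_coord_le u r : u 0 r ^+ 2 <= sqnorm u.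
Proof.
rewrite /sqnorm /dot (bigD1 r) //= expr2 lerDl.
by apply: sumr_ge0 => s _; rewrite -expr2 sqr_ge0.
Qed.

Lemma sqnorm_ge0 u : 0 <= sqnorm u.
Proof. by apply: sumr_ge0 => r _; rewrite -expr2 sqr_ge0. Qed.

(** The topology of row vectors comes from the sup norm; this transfers
    Euclidean bounds to it. *)
Lemma sup_norm_le u : `|u| ^+ 2 <= sqnorm u.
Proof.
have [u0|/mx_norm_neq0[[i r] /= uE]] := eqVneq (mx_norm u) 0.
  by rewrite [`|u|]u0 expr0n sqnorm_ge0.
by rewrite [`|u|]uE real_normK ?num_real // (ord1 i) sqr_coord_le.
Qed.

Lemma sqnorm_eq0 u : (sqnorm u == 0) = (u == 0).
Proof.
apply/eqP/eqP => [u0|->]; last exact: dot0r.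
apply/rowP => r; rewrite mxE; apply/eqP; rewrite -sqrf_eq0 eq_le sqr_ge0 andbT.
by rewrite -u0 sqr_coord_le.
Qed.

(** Jensen's inequality for the squared norm.  With m the mean, Young's
    inequality bounds each <m, x_i> by (|m|^2 + B) / 2, and the average of the
    <m, x_i> is |m|^2. *)
Lemma sqnorm_mean_le (I : finType) (A : pred I) (x : I -> 'rV[R]_d) (B : R) :
  (0 < #|A|)%N -> (forall i, A i -> sqnorm (x i) <= B) ->
  sqnorm (#|A|%:R^-1 *: \sum_(i | A i) x i) <= B.
Proof.
move=> A0 xB; set m := _ *: _.
have N0 : (0 : R) < #|A|%:R by rewrite ltr0n.
have young i : A i -> dot m (x i) <= (sqnorm m + B) / 2.
  move=> /xB xiB; have := sqnorm_ge0 (m - x i).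
  rewrite sqnormD sqnormN dotNr; lra.
have : sqnorm m <= (sqnorm m + B) / 2.
  rewrite {1}/sqnorm {2}/m dotZr dot_sumr mulrC ler_pdivrMr //.
  apply: le_trans (ler_sum _ young) _.
  by rewrite sumr_const mulr_natr.
lra.
Qed.

End Euclidean.

(** * Second-order Taylor bounds *)

Section Taylor.
Variable R : realType.

(** The mean value theorem is used twice: on p - m t^2 / 2 between 0 and 1,
    which produces a point c, and on p' between 0 and c. *)
Lemma taylor2_ge (p p1 p2 : R -> R) (m : R) :
  (forall t : R, is_derive t 1 p (p1 t)) ->
  (forall t : R, is_derive t 1 p1 (p2 t)) ->
  (forall t, m <= p2 t) -> p 0 + p1 0 + m / 2 <= p 1.
Proof.
move=> dp dp1 p2m.
pose q t := p t - m / 2 * t ^+ 2.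
have dq (t : R) : is_derive t 1 q (p1 t - m * t).
  have -> : q = p - (m / 2) \*: (@id R) ^+ 2.
    by apply/funext => s; rewrite /q !fctE.
  by apply: is_derive_eq; rewrite /= expr1 /GRing.scale /=; field.
have cont (g g1 : R -> R) (a b : R) :
    (forall t : R, is_derive t 1 g (g1 t)) ->
    {within `[a, b], continuous g}%classic.
  by move=> dg; apply: derivable_within_continuous => t _; have [] := dg t.
have [c c01 qE] := @MVT R q (fun t => p1 t - m * t) 0 1 ltr01
  (fun t _ => dq t) (cont _ _ _ _ dq).
have c0 : 0 < c by move: c01; rewrite in_itv => /andP[].
have [e _ p1E] := @MVT R p1 p2 0 c c0 (fun t _ => dp1 t) (cont _ _ _ _ dp1).
have mc : m * c <= p2 e * c by rewrite ler_pM2r.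
by move: qE p1E; rewrite /q expr0n expr1n /=; lra.
Qed.

Lemma taylor2 (p p1 p2 : R -> R) (m M : R) :
  (forall t : R, is_derive t 1 p (p1 t)) ->
  (forall t : R, is_derive t 1 p1 (p2 t)) ->
  (forall t, m <= p2 t <= M) -> m / 2 <= p 1 - p 0 - p1 0 <= M / 2.
Proof.
move=> dp dp1 p2mM; apply/andP; split.
  have := taylor2_ge dp dp1 (fun t => (andP (p2mM t)).1); lra.
have := @taylor2_ge (- p) (- p1) (- p2) (- M)
  (fun t => is_deriveN (dp t)) (fun t => is_deriveN (dp1 t)).
rewrite !fctE => H; suff: - p 0 + - p1 0 + - M / 2 <= - p 1 by lra.
by apply: H => t; rewrite lerN2; case/andP: (p2mM t).
Qed.

End Taylor.

Section Lines.
Variables (R : realType) (d : nat).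
Implicit Types (f : 'rV[R]_d -> R) (u v w : 'rV[R]_d).

Lemma derive_dot f u v : differentiable f u -> 'D_v f u = dot (gradient f u) v.
Proof.
move=> df; rewrite deriveE // {1}(row_sum_delta v) linear_sum /=.
by apply: eq_bigr => r _; rewrite linearZ /= mxE deriveE // mulrC.
Qed.

Lemma is_derive_line f w v (t : R) : differentiable f (w + t *: v) ->
  is_derive t 1 (fun s : R => f (w + s *: v))
    (dot (gradient f (w + t *: v)) v).
Proof.
move=> df.
have dl : is_diff t (fun s : R => w + s *: v) (fun s : R => s *: v).
  have := is_diffD (is_diff_cst w t) (is_diff_scalel t v).
  by rewrite add0r.
have dlt : differentiable (fun s : R => w + s *: v) t by case: dl.
have dfl : differentiable (f \o (fun s : R => w + s *: v)) t.
  exact: differentiable_comp.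
apply: DeriveDef; first exact: diff_derivable.
by rewrite deriveE // diff_comp //= diff_val scale1r -deriveE // derive_dot.
Qed.

Lemma differentiable_gradient_dot f w v : differentiable (gradient f) w ->
  differentiable (fun u => dot (gradient f u) v) w.
Proof.
move=> dg.
have -> : (fun u => dot (gradient f u) v)
        = \sum_(r < d) v 0 r *: (fun u => gradient f u 0 r).
  apply/funext => u; rewrite fct_sumE; apply: eq_bigr => r _.
  by rewrite mulrC.
apply: differentiable_sum => r; apply: differentiableZ.
exact: (differentiable_comp dg (differentiable_coord _ _ _)).
Qed.

(** The second derivative of f along v is the Hessian quadratic form, read as
    v (H v^T): its double sum then has the mixed partial derivatives in the
    order in which differentiating the gradient along v produces them. *)
Lemma gradient_gradient_dot f w v : differentiable (gradient f) w ->
  dot (gradient (fun u => dot (gradient f u) v) w) v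
  = (v *m hessian f w *m v^T) 0 0.
Proof.
move=> dg.
have dcoord s : differentiable (fun u => 'D_(delta_mx 0 s) f u) w.
  have -> : (fun u => 'D_(delta_mx 0 s) f u) = (fun u => gradient f u 0 s).
    by apply/funext => u; rewrite mxE.
  exact: (differentiable_comp dg (differentiable_coord _ _ _)).
have -> : (v *m hessian f w *m v^T) 0 0
    = \sum_(r < d) (\sum_(s < d) v 0 s * hessian f w r s) * v 0 r.
  rewrite -mulmxA mxE; apply: eq_bigr => r _; rewrite mulrC; congr (_ * _).
  by rewrite mxE; apply: eq_bigr => s _; rewrite [v^T _ _]mxE mulrC.
apply: eq_bigr => r _; rewrite mxE; congr (_ * _).
have -> : (fun u => dot (gradient f u) v)
        = \sum_(s < d) v 0 s *: (fun u => 'D_(delta_mx 0 s) f u).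
  apply/funext => u; rewrite fct_sumE; apply: eq_bigr => s _.
  by rewrite mxE mulrC.
have ds s : is_derive w (delta_mx 0 r)
    (v 0 s *: (fun u => 'D_(delta_mx 0 s) f u)) (v 0 s *: hessian f w r s).
  apply: is_deriveZ; rewrite mxE; apply: DeriveDef => //.
  exact: diff_derivable.
by rewrite (@derive_val _ _ _ _ _ _ _ (is_derive_sum ds)).
Qed.

Lemma loewner_quad_lt (A B : 'M[R]_d) v : loewner_lt A B -> v != 0 ->
  (v *m A *m v^T) 0 0 < (v *m B *m v^T) 0 0.
Proof.
move=> AB v0; have := AB v v0; rewrite mulmxBr mulmxBl.
by set P := v *m B *m _; set Q := v *m A *m _; rewrite !mxE subr_gt0.
Qed.

Lemma loewner_quad_le (A B : 'M[R]_d) v : loewner_lt A B ->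
  (v *m A *m v^T) 0 0 <= (v *m B *m v^T) 0 0.
Proof.
move=> AB; have [->|v0] := eqVneq v 0; first by rewrite !mul0mx.
exact/ltW/loewner_quad_lt.
Qed.

Lemma scalar_quad m v : (v *m m%:M *m v^T) 0 0 = m * sqnorm v.
Proof.
rewrite mul_mx_scalar -scalemxAl !mxE; congr (_ * _).
by apply: eq_bigr => r _; rewrite mxE.
Qed.

(** The Bregman divergence of f between w + v and w: the remainder of the
    first-order expansion.  Being linear in f, it lets both curvature bounds
    pass to averages of functions at once. *)
Definition bregman f w v : R := f (w + v) - f w - dot (gradient f w) v.

(** Lower bound: m-strong convexity.  Upper bound: the descent inequality of
    a function with M-Lipschitz gradient. *)
Definition bregman_between m M f : Prop := forall w v,
  m / 2 * sqnorm v <= bregman f w v <= M / 2 * sqnorm v.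

Lemma bregman_between_hessian m M f : twice_differentiable f ->
  (forall u, loewner_lt m%:M (hessian f u) /\ loewner_lt (hessian f u) M%:M) ->
  bregman_between m M f.
Proof.
move=> df hess w v; rewrite /bregman.
have := @taylor2 R (fun t => f (w + t *: v))
  (fun t => dot (gradient f (w + t *: v)) v)
  (fun t => (v *m hessian f (w + t *: v) *m v^T) 0 0)
  (m * sqnorm v) (M * sqnorm v) _ _ _.
rewrite scale0r scale1r addr0 2!(mulrAC _ (sqnorm v)); apply => t.
- by apply: is_derive_line; have [] := df (w + t *: v).
- have [_ dg] := df (w + t *: v); rewrite -gradient_gradient_dot //.
  apply: (is_derive_line (f := fun u => dot (gradient f u) v)).
  exact: differentiable_gradient_dot.
- have [/loewner_quad_le mh /loewner_quad_le hM] := hess (w + t *: v).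
  by rewrite -!scalar_quad mh hM.
Qed.

End Lines.

(** * Minimizers of smooth strongly convex functions *)

Section Minimizer.
Variables (R : realType) (d : nat) (F : 'rV[R]_d -> R) (m L : R).
Hypotheses (m0 : 0 < m) (L0 : 0 < L) (FmL : bregman_between m L F).
Implicit Types u v w : 'rV[R]_d.

Let Fconv w v :
  F w + dot (gradient F w) v + m / 2 * sqnorm v <= F (w + v).
Proof. have /andP[+ _] := FmL w v; rewrite /bregman; lra. Qed.

Let Fsmooth w v :
  F (w + v) <= F w + dot (gradient F w) v + L / 2 * sqnorm v.
Proof. have /andP[_] := FmL w v; rewrite /bregman; lra. Qed.

(** The quadratic lower model of F at w is minimized over R^d by completing the
    square |m x + grad F(w)|^2 >= 0. *)
Lemma polyak_lojasiewicz w v : F w - F v <= sqnorm (gradient F w) / (2 * m).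
Proof.
have := Fconv w (v - w); rewrite (addrC w (v - w)) subrK.
have := sqnorm_ge0 (m *: (v - w) + gradient F w).
move: (v - w) => x; rewrite sqnormD sqnormZ dotZl dotC.
set a := dot _ _; set N := sqnorm x; set G := sqnorm _ => h1 h2.
rewrite ler_pdivlMr ?mulr_gt0 //.
have : (F w + a + m / 2 * N) * m <= F v * m by rewrite ler_pM2r.
nra.
Qed.

(** A gradient step of length 1/L decreases F by at least |grad F|^2 / (2 L),
    and cannot go below the minimum. *)
Lemma gradient_le_gap w v : (forall u, F v <= F u) ->
  sqnorm (gradient F w) <= 2 * L * (F w - F v).
Proof.
move=> /(_ (w + (- L^-1) *: gradient F w)) vmin.
have := le_trans vmin (Fsmooth w (- L^-1 *: gradient F w)).
rewrite dotZr sqnormZ -/(sqnorm _); set G := sqnorm _ => h.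
have : F v * L <= (F w + - L^-1 * G + L / 2 * ((- L^-1) ^+ 2 * G)) * L.
  by rewrite ler_pM2r.
have -> : (F w + - L^-1 * G + L / 2 * ((- L^-1) ^+ 2 * G)) * L
   = F w * L - G / 2 by field; exact: lt0r_neq0.
lra.
Qed.

Lemma minimizer_unique w v : (forall u, F w <= F u) ->
  (forall u, F v <= F u) -> w = v.
Proof.
move=> wmin vmin; have Fwv : F w = F v by apply/le_anti; rewrite wmin vmin.
have g0 : sqnorm (gradient F v) <= 0.
  by have := gradient_le_gap v vmin; rewrite subrr mulr0.
have {}g0 : gradient F v = 0.
  by apply/eqP; rewrite -sqnorm_eq0 eq_le g0 sqnorm_ge0.
have := Fconv v (w - v).
rewrite (addrC v (w - v)) subrK g0 (dotC 0) dot0r Fwv => h.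
apply/eqP; rewrite -subr_eq0 -sqnorm_eq0 eq_le sqnorm_ge0 andbT.
have : m / 2 * sqnorm (w - v) <= 0 by lra.
by rewrite pmulr_rle0 // divr_gt0.
Qed.

(** Completing the square in the quadratic lower model at 0 shows that
    F(w) <= F(0) confines w to the ball of centre - grad F(0) / m and radius
    |grad F(0)| / m; a minimizer over this compact sublevel set is global. *)
Lemma minimizer_exists : continuous F -> exists v, forall u, F v <= F u.
Proof.
move=> Fcont; pose A := [set w | F w <= F 0]%classic.
have Acl : closed A.
  apply: (@preimage_closed _ _ F [set x | x <= F 0]%classic).
    by move=> w _; exact: Fcont.
  exact: closed_le.
have Abd : bounded_set A.
  pose c := m^-1 *: gradient F 0.
  pose D := sqnorm c.
  have ball w : A w -> sqnorm (w + c) <= D.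
    rewrite /A /= sqnormD -/D => Fw.
    have := Fconv 0 w; rewrite add0r => Fw_ge.
    have -> : dot w c = m^-1 * dot (gradient F 0) w by rewrite dotZr dotC.
    have : (dot (gradient F 0) w + m / 2 * sqnorm w) * (2 / m) <= 0.
      rewrite pmulr_lle0 ?divr_gt0 //; lra.
    have -> : (dot (gradient F 0) w + m / 2 * sqnorm w) * (2 / m)
      = 2 * (m^-1 * dot (gradient F 0) w) + sqnorm w.
      by field; exact: lt0r_neq0.
    lra.
  have D0 : 0 <= D := sqnorm_ge0 c.
  exists (1 + D + `|c|); split; first exact: num_real.
  move=> M /ltW DM w /ball wc; apply: le_trans DM.
  have -> : w = (w + c) - c by rewrite addrK.
  apply: le_trans (ler_normB _ _) _; rewrite lerD2r.
  (* x^2 <= D implies x <= 1 + D, which avoids a square root. *)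
  have : `|w + c| ^+ 2 <= D := le_trans (sup_norm_le _) wc.
  by have := sqr_ge0 (`|w + c| - 1); nra.
have [v Av vmin] : exists2 c, c \in A & forall t, t \in A -> F c <= F t.
  apply: compact_EVT_min.
  - by exists 0; rewrite /A /=.
  - exact: bounded_closed_compact.
  - exact: continuous_subspaceT.
exists v => u; case: (leP (F u) (F 0)) => [Fu|/ltW Fu].
  by apply: vmin; rewrite inE.
by apply: le_trans Fu; move: Av; rewrite inE.
Qed.

End Minimizer.

(** * The average of the component functions *)

Section Objective.
Variables (R : realType) (n d : nat) (f : 'I_n -> 'rV[R]_d -> R).
Hypothesis n0 : (0 < n)%N.

Lemma objectiveE : objective f = n%:R^-1 *: \sum_(i < n) f i.
Proof. by apply/funext => w; rewrite /objective !fctE fct_sumE. Qed.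

Lemma differentiable_objective w : (forall i, differentiable (f i) w) ->
  differentiable (objective f) w.
Proof.
by move=> df; rewrite objectiveE; apply/differentiableZ/differentiable_sum.
Qed.

Lemma gradient_objective w : (forall i, differentiable (f i) w) ->
  gradient (objective f) w = full_mean (fun i => gradient (f i) w).
Proof.
move=> df; apply/rowP => r; rewrite !mxE summxE objectiveE.
have dfi i : is_derive w (delta_mx 0 r) (f i) (gradient (f i) w 0 r).
  by apply: DeriveDef; [exact: diff_derivable | rewrite mxE].
exact: (@derive_val _ _ _ _ _ _ _ (is_deriveZ _ (is_derive_sum dfi))).
Qed.

Lemma bregman_objective w v : (forall i, differentiable (f i) w) ->
  bregman (objective f) w v = n%:R^-1 * \sum_(i < n) bregman (f i) w v.
Proof.
move=> df; rewrite /bregman gradient_objective // /full_mean dotZl.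
rewrite dotC dot_sumr !sumrB !mulrBr; congr (_ - _ * _).
by apply: eq_bigr => i _; rewrite dotC.
Qed.

Lemma bregman_between_objective m M : (forall i w, differentiable (f i) w) ->
  (forall i, bregman_between m M (f i)) -> bregman_between m M (objective f).
Proof.
move=> df fmM w v; rewrite bregman_objective //.
have n0' : (0 : R) < n%:R by rewrite ltr0n.
have cst_mean (a : R) : a = n%:R^-1 * \sum_(i < n) a.
  by rewrite sumr_const card_ord -(mulr_natl a n) mulKf ?lt0r_neq0.
apply/andP; split; [rewrite [leLHS]cst_mean | rewrite [leRHS]cst_mean].
  all: rewrite ler_pM2l ?invr_gt0 //.
  all: by apply: ler_sum => i _; case/andP: (fmM i w v).
Qed.

End Objective.

(** * Decay of the gradient along the algorithm *)

Section Algorithm.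
Variables (R : realType) (n b d : nat) (f : 'I_n -> 'rV[R]_d -> R).
Variables (w0 : 'rV[R]_d) (alpha : seq (batch n b) -> R).
Variables (theta : seq (batch n b) -> 'rV[R]_d) (beta : R).
Let st := run alpha theta f w0.
Hypothesis n0 : (0 < n)%N.
Hypothesis hbeta : bounded_ratio beta alpha theta f w0.

Definition constant_batch : batch n b := [tuple of nseq b (Ordinal n0)].

(** beta bounds a quotient of squared norms; evaluating that quotient requires
    an actual mini-batch, hence n > 0. *)
Lemma ratio_bound_ge0 : 0 <= beta.
Proof.
have [/andP[_ h] _] := hbeta [::] constant_batch.
by apply: le_trans h; rewrite divr_ge0 ?sqnorm_ge0.
Qed.

(** Where the previous estimate vanishes, the quotient carries no information
    and the second clause of [bounded_ratio] takes over. *)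
Lemma sqnorm_estimate_le h :
  sqnorm (estimate (st h)) <= beta ^+ size h * sqnorm (estimate (st [::])).
Proof.
elim: h => [|S h IH]; first by rewrite mul1r.
have [/andP[_ ratio] stop] := hbeta h S.
rewrite exprS -mulrA; apply: le_trans (ler_wpM2l ratio_bound_ge0 IH).
have [g0|g_neq0] := eqVneq (estimate (st h)) 0.
  by rewrite /st (stop g0) -/st g0 /sqnorm dot0r mulr0.
by rewrite -ler_pdivrMr // lt_def sqnorm_eq0 g_neq0 sqnorm_ge0.
Qed.

(** Conditionally on omega_k, the gradient is the mean of the estimates g_k over
    the histories that lead to the same iterate, and all of them obey the same
    bound. *)
Lemma sqnorm_gradient_le k (h : k.-tuple (batch n b)) :
  unbiased alpha theta f w0 ->
  sqnorm (gradient (objective f) (iterate (st h)))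
    <= beta ^+ k * sqnorm (estimate (st [::])).
Proof.
move=> /(_ k h) <-; rewrite /cond_expect.
apply: sqnorm_mean_le => [|h' _]; first by apply/card_gt0P; exists h; exact/eqP.
by have := sqnorm_estimate_le h'; rewrite size_tuple.
Qed.

Lemma expect_le k (X : k.-tuple (batch n b) -> R) (B : R) :
  (forall h, X h <= B) -> expect X <= B.
Proof.
move=> XB; rewrite /expect mulrC ler_pdivrMr; last first.
  by rewrite ltr0n; apply/card_gt0P; exists [tuple of nseq k constant_batch].
apply: le_trans (ler_sum _ (fun h _ => XB h)) _.
by rewrite sumr_const mulr_natr.
Qed.

Lemma expect0 (X : 0.-tuple (batch n b) -> R) : expect X = X [tuple].
Proof.
rewrite /expect card_tuple expn0 invr1 mul1r (bigD1 [tuple]) //= big1 ?addr0 //.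
by move=> h /eqP[]; exact: tuple0.
Qed.

End Algorithm.

Theorem theorem1 (R : realType) (n b d : nat) (hn : (0 < n)%N) (hb : (2 <= b)%N)
  (f : 'I_n -> 'rV[R]_d -> R) (w0 : 'rV[R]_d)
  (alpha : seq (batch n b) -> R) (theta : seq (batch n b) -> 'rV[R]_d)
  (sigma1 sigma2 mu L alpha1 alpha2 beta : R)
  (hsigma : 0 < sigma1 /\ sigma1 < sigma2 /\ sigma2 < 1)
  (hwolfe : strong_wolfe sigma1 sigma2 alpha theta f w0)
  (hunbiased : unbiased alpha theta f w0)
  (hmu : 0 < mu) (hL : 0 < L)
  (hf : forall i : 'I_n, twice_differentiable (f i))
  (hhess : forall (i : 'I_n) (w : 'rV[R]_d),
     loewner_lt mu%:M (hessian (f i) w) /\ loewner_lt (hessian (f i) w) L%:M)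
  (halpha : forall h : seq (batch n b), alpha1 <= alpha h <= alpha2)
  (hbeta : bounded_ratio beta alpha theta f w0)
  (halpha1 : 0 < alpha1 /\ alpha1 < (1 - beta) / (2 * L * sigma1)) :
  let F := objective f in
  let xi := 1 - 2 * mu * sigma1 * alpha1 in
  let Ef := fun k : nat =>
    expect (fun h : k.-tuple (batch n b) =>
              F (iterate (run alpha theta f w0 h))) in
  xi < 1 /\
  exists wstar : 'rV[R]_d,
    (forall w : 'rV[R]_d, F wstar <= F w) /\
    (forall w : 'rV[R]_d, (forall v : 'rV[R]_d, F w <= F v) -> w = wstar) /\
    (exists C : R, forall k : nat, (0 < k)%N ->
       Ef k - F wstar <= C * xi ^+ k * (Ef 0%N - F wstar)).
Proof.
move=> F xi Ef.
have [alpha1_gt0 alpha1_lt] := halpha1; have [sigma1_gt0 _] := hsigma.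
have df i w : differentiable (f i) w by have [] := hf i w.
have FmL : bregman_between mu L F.
  apply: bregman_between_objective => // i.
  by apply: bregman_between_hessian => // u; exact: hhess.
have g0E : estimate (run alpha theta f w0 [::]) = gradient F w0.
  by rewrite gradient_objective.
have Fcont : continuous F.
  move=> w; apply: differentiable_continuous.
  exact: differentiable_objective.
split; first by rewrite ltrBlDr ltrDl !mulr_gt0.
have [v vmin] := minimizer_exists hmu FmL Fcont.
exists v; split=> //; split=> [w wmin|].
  exact: (minimizer_unique hmu hL FmL wmin vmin).
exists (L / mu) => k _.
rewrite [Ef 0%N]expect0.
rewrite lerBlDr; apply: expect_le => // h; rewrite -lerBlDr.
set B := (X in _ <= X).
set D := F w0 - F v.
have D0 : 0 <= D by rewrite subr_ge0.
apply: le_trans (polyak_lojasiewicz hmu FmL _ v) _.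
rewrite ler_pdivrMr ?mulr_gt0 //.
apply: le_trans (sqnorm_gradient_le hn hbeta h hunbiased) _.
rewrite g0E; have gap := gradient_le_gap hL FmL w0 vmin.
have beta0 := ratio_bound_ge0 hn hbeta.
apply: le_trans (ler_wpM2l (exprn_ge0 k beta0) gap) _.
rewrite /B -/D.
have -> : L / mu * xi ^+ k * D * (2 * mu) = xi ^+ k * (2 * L * D).
  by field; exact: lt0r_neq0.
have [->|Dn0] := eqVneq D 0; first by rewrite !mulr0.
(* A nonzero vector is needed to compare mu and L: in dimension 0 the Hessian
   bounds say nothing.  Away from the optimum the gradient is one. *)
have mu_lt_L : mu < L.
  have g_neq0 : gradient F w0 != 0.
    apply: contra_neq Dn0 => g0; apply/eqP; rewrite eq_le D0 andbT.
    have := polyak_lojasiewicz hmu FmL w0 v.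
    by rewrite g0 /sqnorm dot0r mul0r.
  have [h1 h2] := hhess (Ordinal hn) w0.
  have := lt_trans (loewner_quad_lt h1 g_neq0) (loewner_quad_lt h2 g_neq0).
  by rewrite !scalar_quad ltr_pM2r // lt_def sqnorm_eq0 g_neq0 sqnorm_ge0.
have beta_xi : beta <= xi.
  have : mu * (sigma1 * alpha1) <= L * (sigma1 * alpha1).
    by rewrite ler_wpM2r ?mulr_ge0 // ltW.
  move: alpha1_lt; rewrite ltr_pdivlMr ?mulr_gt0 // /xi.
  lra.
apply: ler_wpM2r; first by rewrite !mulr_ge0 // ltW.
by apply: lerXn2r => //; rewrite nnegrE // (le_trans beta0).
Qed.
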